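(* Let $\ell>0$, $T>0$, $Q_T=(0,\ell)\times(0,T)$, $\overline{Q}_T=[0,\ell]\times[0,T]$. Let $n,m\ge 1$, $0<\alpha_1<\dots<\alpha_n\le 1$, $0<\beta_1<\dots<\beta_m\le 1$, and let $p_i,q_j\in C(\overline{Q}_T)$ ($1\le i\le n$, $1\le j\le m$) be real-valued with $p_i\ge 0$ and $q_j\ge 0$ in $Q_T$ for all $i,j$, and $\sum_{i=1}^n p_i(x,t)>0$ for all $(x,t)\in\overline{Q}_T$. For $r,F\in C(\overline{Q}_T)$ with $r\le 0$ on $\overline{Q}_T$, and functions $a$ on $[0,\ell]$ and $g$ on $[0,T]$, let $u_{r,a,g,F}$ denote a real-valued function $u$ with $u\in C(\overline{Q}_T)$, $u(\cdot,t)\in W^{1,1}(0,\ell)$ for $t\in(0,T)$, $u(x,\cdot)\in W^{1,1}(0,T)$ for $x\in(0,\ell)$, satisfying $$\sum_{i=1}^n p_i(x,t)\,\partial_t^{\alpha_i}u(x,t)+\sum_{j=1}^m q_j(x,t)\,\partial_x^{\beta_j}u(x,t)=r(x,t)u(x,t)+F(x,t),\qquad (x,t)\in Q_T,$$ $$u(0,t)=g(t),\ 0<t<T,\qquad u(x,0)=a(x),\ 0<x<\ell$$ (such functions are assumed to exist for the data below). (i) If $F_1\ge F_2$ on $\overline{Q}_T$, $g_1\ge g_2$ on $[0,T]$, $a_1\ge a_2$ on $[0,\ell]$, and $r\le 0$ on $\overline{Q}_T$, then $$u_{r,a_1,g_1,F_1}(x,t)\ge u_{r,a_2,g_2,F_2}(x,t),\qquad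 (x,t)\in\overline{Q}_T.$$ (ii) If $F_1\ge F_2\ge 0$ on $\overline{Q}_T$, $g_1\ge g_2\ge 0$ on $[0,T]$, $a_1\ge a_2\ge 0$ on $[0,\ell]$, and $0\ge r_1\ge r_2$ on $\overline{Q}_T$, then $$u_{r_1,a_1,g_1,F_1}(x,t)\ge u_{r_2,a_2,g_2,F_2}(x,t),\qquad (x,t)\in\overline{Q}_T.$$
   Context: For $0<\alpha<1$ the Caputo derivative in time is $\partial_t^{\alpha}u(x,t)=\frac{1}{\Gamma(1-\alpha)}\int_0^t(t-s)^{-\alpha}\frac{\partial}{\partial s}u(x,s)\,ds$; for $0<\beta<1$ the Caputo derivative in space is $\partial_x^{\beta}u(x,t)=\frac{1}{\Gamma(1-\beta)}\int_0^x(x-y)^{-\beta}\frac{\partial}{\partial y}u(y,t)\,dy$. For $\alpha=1$ or $\beta=1$ these are the ordinary first-order partial derivatives. $W^{1,1}(0,T)$ is the space of $g\in L^1(0,T)$ with weak derivative in $L^1(0,T)$, and similarly for $W^{1,1}(0,\ell)$. The equation is understood to hold at every point $(x,t)\in Q_T$, with all derivatives occurring in it existing there (the integrals above being absolutely convergent). *)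

(* Defs.v *)
From HB Require Import structures.
From mathcomp Require Import all_boot all_order all_algebra.
From mathcomp Require Import all_classical all_reals all_analysis.
Set Implicit Arguments.
Unset Strict Implicit.
Unset Printing Implicit Defensive.
Import Order.TTheory GRing.Theory Num.Theory.
Import numFieldNormedType.Exports.
Local Open Scope classical_set_scope.
Local Open Scope ring_scope.

Definition Gamma (R : realType) (z : R) : R :=
  \int[@lebesgue_measure R]_(s in `]0, +oo[) (s `^ (z - 1) * expR (- s)).

Definition test_function (R : realType) (a b : R) (phi : R -> R) : Prop :=
  [/\ forall (k : nat) (x : R), derivable (derive1n k phi) x 1,
      compact (closure [set x | phi x != 0])
    & closure [set x | phi x != 0] `<=` `]a, b[].

Definition weak_derivative (R : realType) (a b : R) (f v : R -> R) : Prop :=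
  forall phi : R -> R, test_function a b phi ->
    \int[@lebesgue_measure R]_(x in `]a, b[) (f x * derive1 phi x) =
    - \int[@lebesgue_measure R]_(x in `]a, b[) (v x * phi x).

Definition W11 (R : realType) (a b : R) (f : R -> R) : Prop :=
  (@lebesgue_measure R).-integrable `]a, b[ (EFin \o f) /\
  exists2 v : R -> R,
    (@lebesgue_measure R).-integrable `]a, b[ (EFin \o v) &
    weak_derivative a b f v.

(* A continuous W^{1,1} function is differentiable almost everywhere and its
   pointwise derivative agrees a.e. with its weak one, so the value of
   [derive1 f s] at the exceptional points does not affect the integrals below. *)
Definition caputo_kernel (R : realType) (alpha : R) (f : R -> R) (t s : R) : R :=
  (t - s) `^ (- alpha) * derive1 f s.

Definition caputo (R : realType) (alpha : R) (f : R -> R) (t : R) : R :=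
  if alpha < 1 then
    (Gamma (1 - alpha))^-1 *
    \int[@lebesgue_measure R]_(s in `]0, t[) caputo_kernel alpha f t s
  else derive1 f t.

(* [caputo] is total; this says that its value at [t] is meaningful. *)
Definition caputo_exists (R : realType) (alpha : R) (f : R -> R) (t : R) : Prop :=
  if alpha < 1 then
    (@lebesgue_measure R).-integrable `]0, t[
      (EFin \o caputo_kernel alpha f t) : Prop
  else derivable f t 1.

(* Functions on the closed rectangle are represented by total functions
   R -> R -> R, whose values outside the rectangle are irrelevant. *)
Definition continuous_on_rect (R : realType) (l T : R) (f : R -> R -> R) : Prop :=
  {within [set z : R * R | 0 <= z.1 <= l /\ 0 <= z.2 <= T],
    continuous (fun z : R * R => f z.1 z.2)}.

Record is_solution (R : realType) (l T : R) (n m : nat)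
    (alpha : 'I_n -> R) (beta : 'I_m -> R)
    (p : 'I_n -> R -> R -> R) (q : 'I_m -> R -> R -> R)
    (r : R -> R -> R) (a g : R -> R) (F u : R -> R -> R) : Prop := IsSolution {
  sol_continuous : continuous_on_rect l T u;
  sol_W11_space : forall t, 0 < t < T -> W11 0 l (fun x => u x t);
  sol_W11_time : forall x, 0 < x < l -> W11 0 T (fun t => u x t);
  sol_caputo_time : forall x t, 0 < x < l -> 0 < t < T ->
    forall i, caputo_exists (alpha i) (fun s => u x s) t;
  sol_caputo_space : forall x t, 0 < x < l -> 0 < t < T ->
    forall j, caputo_exists (beta j) (fun y => u y t) x;
  sol_equation : forall x t, 0 < x < l -> 0 < t < T ->
    \sum_(i < n) p i x t * caputo (alpha i) (fun s => u x s) t +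
    \sum_(j < m) q j x t * caputo (beta j) (fun y => u y t) x =
    r x t * u x t + F x t;
  sol_boundary : forall t, 0 < t < T -> u 0 t = g t;
  sol_initial : forall x, 0 < x < l -> u x 0 = a x
}.

(* Main.v *)
Require Import Defs.
From HB Require Import structures.
From mathcomp Require Import all_boot all_order all_algebra.
From mathcomp Require Import all_classical all_reals all_analysis.
From mathcomp Require Import measurable_realfun ring lra.
Set Implicit Arguments.
Unset Strict Implicit.
Unset Printing Implicit Defensive.
Import Order.TTheory GRing.Theory Num.Theory.
Import numFieldNormedType.Exports.
Local Open Scope classical_set_scope.
Local Open Scope ring_scope.

(* Let w = u1 - u2 and suppose that w is negative at an interior point (x0, t0).
   Minimise W = w + e t over [0, x0] x [0, t0] for a small e > 0: since w >= 0
   on the parabolic boundary, the minimum (y, s) is attained with y, s > 0, so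
   the equations hold there. For a continuous W^{1,1} function with weak
   derivative v the Caputo integral is the integral of the nondecreasing kernel
   (s - tau)^(-alpha) against v, and such an integral is at most
   s^(-alpha) (f(s) - f(0)) when f >= f(s) on [0, s]: write the kernel minus its
   value at 0 as a limit of positive combinations of indicators of intervals
   ]c, s[, over which v integrates to f(s) - f(c) <= 0. Hence every time
   derivative of w is negative at (y, s) and every space derivative is
   nonpositive, which contradicts the equations because sum p_i > 0. *)

(** * A smooth step *)

Lemma is_derive1V {R : realType} (f : R -> R) (x df : R) :
  f x != 0 -> is_derive x 1 f df ->
  is_derive x 1 (fun y => (f y)^-1) (- df / f x ^+ 2).
Proof.
move=> fx0 [dvf <-]; apply: DeriveDef; first exact: derivableV.
by rewrite deriveV// /GRing.scale/= mulNr mulrC mulNr.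
Qed.

Section SmoothStep.
Context {R : realType}.
Implicit Types (f g : R -> R) (x c : R).

(** The factor [x ^- n] makes the family stable under differentiation up to linear combinations, so
    every derivative of the classical flat function [flat 0] is a combination of its members. *)
Definition flat (n : nat) x : R :=
  if 0 < x then x ^- n * expR (- x^-1) else 0.

Lemma flat_ge0 n x : 0 <= flat n x.
Proof.
rewrite /flat; case: ifP => // x0.
by rewrite mulr_ge0 ?expR_ge0// invr_ge0 exprn_ge0// ltW.
Qed.

Lemma flat_gt0 n x : (0 < flat n x) = (0 < x).
Proof.
rewrite /flat; case: ifP => [x0|_]; last by rewrite ltxx.
by rewrite mulr_gt0 ?expR_gt0// invr_gt0 exprn_gt0.
Qed.

Lemma flat_le0 n x : x <= 0 -> flat n x = 0.
Proof. by move=> x0; rewrite /flat ltNge x0. Qed.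

(** For positive [x], the exponential of [x^-1] dominates the term of degree [n.+2] of its series.
    The quadratic order is what forces a zero derivative at the origin. *)
Lemma flat_le n x : flat n x <= (n.+2)`!%:R * x ^+ 2.
Proof.
rewrite /flat; case: ifP => [x0|_]; last by rewrite mulr_ge0// sqr_ge0.
have xn0 : 0 < x ^+ n by rewrite exprn_gt0.
have := @expR_ge1Dxn R x^-1 n.+1; rewrite invr_ge0 ltW// => /(_ isT) h.
have {}h : (x^-1) ^+ n.+2 / (n.+2)`!%:R <= expR (x^-1).
  by apply: le_trans h; rewrite lerDr.
rewrite expRN -invfM -[leRHS]invrK.
rewrite lef_pV2 ?posrE ?invr_gt0 ?mulr_gt0 ?expR_gt0 ?ltr0n ?fact_gt0 ?exprn_gt0//.
rewrite invfM -[leLHS](mulVKf (lt0r_neq0 xn0)) ler_pM2l//.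
apply: le_trans h; rewrite le_eqVlt; apply/orP; left; apply/eqP.
rewrite -[n.+2]addn2 exprD exprVn; field.
by rewrite !gt_eqF// ltr0n fact_gt0.
Qed.

Lemma is_derive_flat n x :
  is_derive x 1 (flat n) (flat n.+2 x - n%:R * flat n.+1 x).
Proof.
case: (ltgtP 0 x) => [x0|x0|<-].
- have : is_derive x 1 (fun y => (y ^+ n)^-1 * expR (- y^-1))
    (flat n.+2 x - n%:R * flat n.+1 x).
    have xn0 : x ^+ n != 0 by rewrite expf_neq0// lt0r_neq0.
    have xx0 : x != 0 by rewrite lt0r_neq0.
    have h1 : is_derive x 1 (fun y : R => (y ^+ n)^-1)
        (- (n%:R * x ^+ n.-1) / (x ^+ n) ^+ 2).
      apply: (@is_derive1V _ (fun y => y ^+ n)) => //.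
      have := @is_deriveX _ _ id n x 1 1 (is_derive_id _ _).
      by rewrite exprfctE /GRing.scale/= mulr1.
    have h2 : is_derive x 1 (fun y : R => - y^-1) (1 / x ^+ 2).
      rewrite -[1 / x ^+ 2]opprK -mulNr; apply: is_deriveN.
      exact: (@is_derive1V _ id).
    have h3 := @is_derive1_comp _ expR _ x _ _ (is_derive_expR _) h2.
    apply: (is_derive_eq (is_deriveM h1 h3)).
    rewrite /flat x0 /GRing.scale/= !exprS.
    case: n xn0 h1 => [|n] xn0 h1; first by rewrite /= !expr0; field.
    rewrite /= !exprS.
    have xn1 : x ^+ n != 0 by rewrite expf_neq0.
    field.
    by rewrite xn1 xx0.
  apply: near_eq_is_derive.
  by near=> y; rewrite /flat ifT//; near: y; exact: lt_nbhsr.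
- rewrite /flat !ltNge (ltW x0)/= mulr0 subr0.
  have := is_derive_cst (0 : R) x 1; apply: near_eq_is_derive.
  near=> y; rewrite ifF//; apply/negbTE; rewrite -leNgt ltW//.
  by near: y; exact: lt_nbhsl.
- rewrite /flat ltxx mulr0 subr0.
  (* By [flat_le] the difference quotient at 0 is at most [(n.+2)!] times the absolute value of
     [h]. *)
  have key :
      (fun h : R => h^-1 *: ((flat n \o shift 0) (h *: 1) - flat n 0)) @ 0^'
        --> (0 : R).
    apply/cvgrPdist_le => e e0.
    have C0 : 0 < (n.+2)`!%:R :> R by rewrite ltr0n fact_gt0.
    near=> h.
    have h0 : h != 0 by near: h; exact: nbhs_dnbhs_neq.
    rewrite sub0r normrN /= addr0 -[h *: 1]/(h * 1) mulr1 (@flat_le0 n 0)// subr0.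
    rewrite -[_ *: _]/(_ * _) normrM normfV (ger0_norm (flat_ge0 _ _)).
    rewrite ler_pdivrMl ?normr_gt0//.
    apply: (le_trans (flat_le _ _)).
    rewrite expr2 -[h * h]ger0_norm -?expr2 ?sqr_ge0// expr2 normrM mulrCA ler_wpM2l//.
    rewrite mulrC -ler_pdivlMr//.
    by near: h; apply: dnbhs0_le; rewrite divr_gt0.
  apply: DeriveDef.
    by apply/cvg_ex; exists 0.
  exact/cvg_lim.
Unshelve. all: end_near. Qed.

(* Closed under differentiation, hence made of C^infinity functions. *)
Inductive smooth_expr : (R -> R) -> Prop :=
| SmoothFlat n : smooth_expr (flat n)
| SmoothCst c : smooth_expr (fun=> c)
| SmoothAdd f g : smooth_expr f -> smooth_expr g ->
    smooth_expr (fun x => f x + g x)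
| SmoothMul f g : smooth_expr f -> smooth_expr g ->
    smooth_expr (fun x => f x * g x)
| SmoothInv f : (forall x, f x != 0) -> smooth_expr f ->
    smooth_expr (fun x => (f x)^-1)
| SmoothAffine f a b : smooth_expr f -> smooth_expr (fun x => f (a * x + b)).

Lemma smooth_expr_is_derive f : smooth_expr f ->
  exists2 g, smooth_expr g & forall x, is_derive x 1 f (g x).
Proof.
elim=> {f} [n|c|f g _ [df sf df'] _ [dg sg dg']|f g sf' [df sf df'] sg' [dg sg dg']|
  f f0 sf' [df sf df']|f a b _ [df sf df']].
- exists (fun x => flat n.+2 x + (- n%:R) * flat n.+1 x).
    apply: SmoothAdd; first exact: SmoothFlat.
    by apply: SmoothMul; [exact: SmoothCst|exact: SmoothFlat].
  by move=> x; rewrite mulNr; exact: is_derive_flat.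
- exists (fun=> 0); first exact: SmoothCst.
  by move=> x; exact: is_derive_cst.
- exists (fun x => df x + dg x); first exact: SmoothAdd.
  by move=> x; exact: is_deriveD.
- exists (fun x => f x * dg x + g x * df x).
    by apply: SmoothAdd; exact: SmoothMul.
  by move=> x; exact: is_deriveM.
- exists (fun x => (-1 * df x) * ((f x)^-1 * (f x)^-1)).
    apply: SmoothMul; first by apply: SmoothMul => //; exact: SmoothCst.
    by apply: SmoothMul; exact: SmoothInv.
  move=> x; rewrite mulN1r -invfM -expr2; exact: is_derive1V.
- exists (fun x => df (a * x + b) * a).
    by apply: SmoothMul; [exact: SmoothAffine|exact: SmoothCst].
  move=> x; apply: (@is_derive1_comp _ f (fun x => a * x + b)) => //.
  have h := @is_deriveM _ _ (fun=> a) id x 1 _ _ (is_derive_cst _ _ _) (is_derive_id _ _).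
  have := is_deriveD h (is_derive_cst b x 1).
  by rewrite /GRing.scale/= mulr1 mulr0 !addr0.
Qed.

Lemma smooth_exprB f g : smooth_expr f -> smooth_expr g ->
  smooth_expr (fun x => f x - g x).
Proof.
move=> sf sg; rewrite (_ : (fun _ => _) = fun x => f x + (-1) * g x).
  by apply: SmoothAdd => //; apply: SmoothMul => //; exact: SmoothCst.
by apply/funext => x; rewrite mulN1r.
Qed.

Lemma smooth_expr_derivable f x : smooth_expr f -> derivable f x 1.
Proof. by move=> /smooth_expr_is_derive[g _ /(_ x) []]. Qed.

Lemma smooth_expr_derive1 f : smooth_expr f -> smooth_expr (derive1 f).
Proof.
move=> /smooth_expr_is_derive[g sg fg]; rewrite (_ : derive1 f = g)//.
by apply/funext => x; rewrite derive1E; apply: derive_val.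
Qed.

Lemma smooth_expr_derivable_n f n x : smooth_expr f -> derivable (derive1n n f) x 1.
Proof.
move=> sf; apply: smooth_expr_derivable; elim: n => [|n IH].
  by rewrite derive1n0.
by rewrite derive1nS; exact: smooth_expr_derive1.
Qed.

Lemma smooth_expr_continuous f : smooth_expr f -> continuous f.
Proof.
by move=> sf x; apply/differentiable_continuous/derivable1_diffP/smooth_expr_derivable.
Qed.

(** The standard smooth transition from 0 (left of 0) to 1 (right of 1). The denominator never
    vanishes because [x] and [1 - x] cannot both be nonpositive. *)
Definition step x : R := flat 0 x / (flat 0 x + flat 0 (1 - x)).

Lemma step_den_gt0 x : 0 < flat 0 x + flat 0 (1 - x).
Proof.
have [x0|x0] := ltP 0 x; first by rewrite ltr_pwDl ?flat_gt0// flat_ge0.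
by rewrite ltr_wpDl ?flat_ge0// flat_gt0 subr_gt0 (le_lt_trans x0).
Qed.

Lemma step_le0 x : x <= 0 -> step x = 0.
Proof. by move=> x0; rewrite /step flat_le0// mul0r. Qed.

Lemma step_ge1 x : 1 <= x -> step x = 1.
Proof.
move=> x1; have := step_den_gt0 x.
rewrite /step (@flat_le0 0 (1 - x)) ?subr_le0// addr0 => x0.
by rewrite divff// gt_eqF.
Qed.

Lemma step_ge0_le1 x : 0 <= step x <= 1.
Proof.
have d0 := step_den_gt0 x; rewrite /step divr_ge0 ?flat_ge0 ?(ltW d0)//=.
by rewrite ler_pdivrMr ?step_den_gt0// mul1r lerDl flat_ge0.
Qed.

Lemma smooth_step : smooth_expr step.
Proof.
rewrite /step; apply: SmoothMul; first exact: SmoothFlat.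
apply: SmoothInv; first by move=> x; rewrite gt_eqF// step_den_gt0.
apply: SmoothAdd; first exact: SmoothFlat.
rewrite (_ : (fun _ => _) = fun x : R => flat 0 (-1 * x + 1)).
  exact/SmoothAffine/SmoothFlat.
by apply/funext => x; rewrite mulN1r addrC.
Qed.

(** In the quotient rule the reflected term [flat 0 (1 - x)] has derivative [- flat 2 (1 - x)], so
    the numerator becomes a sum of two products of nonnegative functions. *)
Lemma step_derive1_ge0 x : 0 <= derive1 step x.
Proof.
have d0 : is_derive x 1 (flat 0) (flat 2 x).
  by have := is_derive_flat 0 x; rewrite mul0r subr0.
have d1 : is_derive x 1 (fun y => flat 0 (1 - y)) (- flat 2 (1 - x)).
  rewrite -mulrN1; apply: (@is_derive1_comp _ (flat 0) (fun y => 1 - y)).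
    by have := is_derive_flat 0 (1 - x); rewrite mul0r subr0.
  have := is_deriveB (is_derive_cst (1 : R) x 1) (is_derive_id x 1).
  by rewrite sub0r.
have x0 := step_den_gt0 x.
have dD := is_deriveD d0 d1.
have dV := @is_derive1V _ (flat 0 + (fun y => flat 0 (1 - y))) x _ (lt0r_neq0 x0) dD.
have dS : is_derive x 1 step _ := is_deriveM d0 dV.
rewrite derive1E derive_val /GRing.scale/=.
rewrite -[(flat 0 + _) x]/(flat 0 x + flat 0 (1 - x)).
rewrite (_ : _ + _ = (flat 2 x * flat 0 (1 - x) + flat 0 x * flat 2 (1 - x)) /
  (flat 0 x + flat 0 (1 - x)) ^+ 2); last by field; exact: lt0r_neq0.
by apply: divr_ge0; [rewrite addr_ge0 ?mulr_ge0 ?flat_ge0|exact: sqr_ge0].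
Qed.

End SmoothStep.

(** * Dominated convergence, and averages against the derivative of a steep step *)

Section Integration.
Context {R : realType}.
Notation mu := (@lebesgue_measure R).
Implicit Types (f g v : R -> R) (a b c s t x : R).

Lemma Rintegral_dominated_convergence (D : set R) (f_ : nat -> R -> R) f g :
  measurable D -> (forall n, measurable_fun D (f_ n)) ->
  (forall x, D x -> f_ n x @[n --> \oo] --> f x) ->
  mu.-integrable D (EFin \o g) -> (forall n x, D x -> `|f_ n x| <= g x) ->
  mu.-integrable D (EFin \o f) /\
  \int[mu]_(x in D) f_ n x @[n --> \oo] --> \int[mu]_(x in D) f x.
Proof.
move=> mD mf_ cf ig fg.
have mf : measurable_fun D f.
  apply: (measurable_fun_cvg mf_) => x Dx; exact: cf.
have [||||fi _ H] := @dominated_convergence _ _ _ mu D mD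
    (fun n => EFin \o f_ n) (EFin \o f) (EFin \o g) _ _ _ ig.
- by move=> n; apply/measurable_EFinP; exact: mf_.
- exact/measurable_EFinP.
- apply: aeW => x Dx /=; apply: cvg_EFin; [exact: nearW|exact: cf].
- by apply: aeW => x n Dx /=; rewrite lee_fin fg.
split => //; apply: fine_cvg; rewrite /Rintegral fineK//.
exact: integrable_fin_num.
Qed.

Lemma continuous_bounded_itv g a b : a <= b -> continuous g ->
  [bounded g x | x in `]a, b[%classic].
Proof.
move=> ab cg.
have [|c _ gc] := @EVT_max _ (fun x => `|g x|) a b ab.
  apply: continuous_subspaceT => x; apply: continuous_comp; first exact: cg.
  exact: norm_continuous.
exists `|g c|; split => // M cM x /= xab; apply/ltW/(le_lt_trans _ cM)/gc.
by apply: subset_itvW xab.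
Qed.

Lemma integrable_mul_continuous f g a b : a <= b ->
  mu.-integrable `]a, b[ (EFin \o f) -> continuous g ->
  mu.-integrable `]a, b[ (EFin \o (fun x => f x * g x)).
Proof.
move=> ab fi cg; have : mu.-integrable `]a, b[ ((EFin \o f) \* (EFin \o g))%E.
  apply: integrableMl => //; last exact: continuous_bounded_itv.
  by apply: measurable_funTS; exact: continuous_measurable_fun.
by apply: eq_integrable.
Qed.

Lemma integrable_continuous_itv g a b : a <= b -> continuous g ->
  mu.-integrable `]a, b[ (EFin \o g).
Proof.
move=> ab cg; apply: (@integrableS _ _ _ mu `[a, b]) => //.
  by apply: subset_itvW.
apply: continuous_compact_integrable; first exact: segment_compact.
exact: continuous_subspaceT.
Qed.

(** For [N > 0] the rise takes place on an interval of length [1 / N]; the derivative is thus a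
    smooth approximation of a Dirac mass. *)
Definition ramp (N d x : R) : R := step (N * x + d).

Lemma smooth_ramp N d : smooth_expr (ramp N d).
Proof. by apply: SmoothAffine; exact: smooth_step. Qed.

Lemma ramp_derive1E N d x : derive1 (ramp N d) x = N * derive1 step (N * x + d).
Proof.
have h := @is_deriveM _ _ (fun=> N) id x 1 _ _ (is_derive_cst _ _ _) (is_derive_id _ _).
have {h} := is_deriveD h (is_derive_cst d x 1).
rewrite /GRing.scale/= mulr1 mulr0 !addr0 => h.
have /derivableP h2 : derivable (@step R) (N * x + d) 1.
  by apply: smooth_expr_derivable; exact: smooth_step.
have {h h2} : is_derive x 1 (ramp N d) _ :=
  @is_derive1_comp _ step (fun y => N * y + d) _ _ _ h2 h.
by move=> [_ h]; rewrite derive1E h derive1E mulrC.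
Qed.

Lemma ramp_derive1_ge0 N d x : 0 <= N -> 0 <= derive1 (ramp N d) x.
Proof. by move=> N0; rewrite ramp_derive1E mulr_ge0// step_derive1_ge0. Qed.

Lemma ramp_derive1_eq0 N d x : ~~ (0 <= N * x + d <= 1) ->
  derive1 (ramp N d) x = 0.
Proof.
rewrite negb_and -!ltNge ramp_derive1E => Nxd.
suff -> : derive1 step (N * x + d) = 0 by rewrite mulr0.
rewrite derive1E; case/orP: Nxd => h.
- rewrite (@near_eq_derive _ R R _ (cst (0:R))) ?derive_cst//.
  near=> y; rewrite step_le0// ltW//; near: y; exact: lt_nbhsl.
- rewrite (@near_eq_derive _ R R _ (cst (1:R))) ?derive_cst//.
  near=> y; rewrite step_ge1// ltW//; near: y; exact: lt_nbhsr.
Unshelve. all: end_near. Qed.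

Lemma ramp_derive1_continuous N d : continuous (derive1 (ramp N d)).
Proof. by apply/smooth_expr_continuous/smooth_expr_derive1/smooth_ramp. Qed.

Lemma Rintegral_ramp_derive1 N d a b : a < b -> N * a + d <= 0 ->
  1 <= N * b + d -> \int[mu]_(x in `]a, b[) derive1 (ramp N d) x = 1.
Proof.
move=> ab Na Nb.
have cr := @ramp_derive1_continuous N d.
have i1 := integrable_continuous_itv (ltW ab) cr.
have ic : mu.-integrable `[a, b] (EFin \o derive1 (ramp N d)).
  by apply: continuous_compact_integrable; [exact: segment_compact|exact: continuous_subspaceT].
rewrite Rintegral_itv_obnd_cbnd//.
rewrite Rintegral_itv_bndo_bndc//; last first.
  by apply: integrableS ic => //; apply: subset_itvl; rewrite bnd_simp.
rewrite /Rintegral (@continuous_FTC2 _ _ (ramp N d))//.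
- by rewrite /= /ramp step_ge1// step_le0// subr0.
- exact: continuous_subspaceT.
- have cc : continuous (ramp N d) by exact/smooth_expr_continuous/smooth_ramp.
  split.
  + by move=> x _; apply/smooth_expr_derivable/smooth_ramp.
  + exact/cvg_at_right_filter/cc.
  + exact/cvg_at_left_filter/cc.
Qed.

(** The derivative of the ramp is nonnegative, has integral 1 and vanishes outside the rise, so the
    integral is a weighted mean of values of [f] that all lie within [e] of [A]. *)
Lemma ramp_average f N d a b A e : a < b -> 0 <= N -> N * a + d <= 0 ->
  1 <= N * b + d -> mu.-integrable `]a, b[ (EFin \o f) ->
  (forall x, a < x < b -> 0 <= N * x + d <= 1 -> `|f x - A| <= e) ->
  `|\int[mu]_(x in `]a, b[) (f x * derive1 (ramp N d) x) - A| <= e.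
Proof.
move=> ab N0 Na Nb fi fA.
have cr := @ramp_derive1_continuous N d.
have i1 := integrable_mul_continuous (ltW ab) fi cr.
have i2 := integrable_continuous_itv (ltW ab) cr.
have iZ c : mu.-integrable `]a, b[ (EFin \o (fun x => c * derive1 (ramp N d) x)).
  by apply: (integrable_mul_continuous (ltW ab) (f := cst c)) => //;
    apply: integrable_continuous_itv => //; [exact: ltW|exact: cst_continuous].
have IZ c : \int[mu]_(x in `]a, b[) (c * derive1 (ramp N d) x) = c.
  by rewrite RintegralZl// Rintegral_ramp_derive1// mulr1.
have key x : x \in `]a, b[ -> (A - e) * derive1 (ramp N d) x <=
    f x * derive1 (ramp N d) x <= (A + e) * derive1 (ramp N d) x.
  rewrite in_itv/= => xab.
  have [h|/ramp_derive1_eq0 ->] := boolP (0 <= N * x + d <= 1); last first.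
    by rewrite !mulr0 lexx.
  have := fA _ xab h; rewrite ler_distl => /andP[h1 h2].
  by rewrite !ler_wpM2r ?ramp_derive1_ge0.
rewrite ler_distl -[X in X <= _](IZ (A - e)) -[X in _ && (_ <= X)](IZ (A + e)).
by apply/andP; split; apply: le_Rintegral => // x /key /andP[].
Qed.

End Integration.

(** * Increments from weak derivatives *)

Lemma within_continuous_dist {R : realType} (T : pseudoMetricType R) (A : set T)
    (f : T -> R) (s : T) (e : R) :
  {within A, continuous f} -> A s -> 0 < e ->
  exists2 d : R, 0 < d & forall x, A x -> ball s d x -> `|f x - f s| <= e.
Proof.
move=> /subspace_continuousP/(_ s) + As e0 => /(_ As)/cvgrPdist_le/(_ e e0).
rewrite near_withinE => /nbhs_ballP[d/= d0 h]; exists d => // x Ax sx.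
by rewrite distrC; exact: h.
Qed.

Section WeakDerivative.
Context {R : realType}.
Notation mu := (@lebesgue_measure R).
Implicit Types (f g v : R -> R) (a b c s t x : R).

Lemma near_infty_mul_ge (K c : R) : 0 < c -> \forall n \near \oo, K <= n.+1%:R * c.
Proof.
move=> c0; exists (Num.truncn `|K / c|).+1 => // n /= Kn.
rewrite -ler_pdivrMr//; apply: (le_trans (ler_norm _)); apply: ltW.
by apply: (lt_le_trans (truncnS_gt _)); rewrite ler_nat ltnW// ltnS.
Qed.

(* A test function tending to the indicator of ]s, t[, whose derivative tends to
   the difference of the Dirac masses at s and t. The offsets keep its support
   inside [s + 1/(n+1), t - 1/(n+1)], so that s and t may be the endpoints of the
   interval of definition. *)
Definition plateau s t n x : R :=
  ramp n.+1%:R (- (n.+1%:R * s) - 1) x - ramp n.+1%:R (- (n.+1%:R * t) + 2) x.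

Lemma smooth_plateau s t n : smooth_expr (plateau s t n).
Proof. by apply: smooth_exprB; exact: smooth_ramp. Qed.

Lemma plateau_le1 s t n x : `|plateau s t n x| <= 1.
Proof.
rewrite /plateau /ramp ler_norml.
by have /andP[? ?] := step_ge0_le1 (n.+1%:R * x + (- (n.+1%:R * s) - 1));
  have /andP[? ?] := step_ge0_le1 (n.+1%:R * x + (- (n.+1%:R * t) + 2)); lra.
Qed.

Lemma plateau_derive1 s t n x : derive1 (plateau s t n) x =
  derive1 (ramp n.+1%:R (- (n.+1%:R * s) - 1)) x -
  derive1 (ramp n.+1%:R (- (n.+1%:R * t) + 2)) x.
Proof.
rewrite !derive1E deriveB//; apply/smooth_expr_derivable; exact: smooth_ramp.
Qed.


(** With [N = n.+1], the first ramp rises on [[s + 1/N, s + 2/N]] and the second on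
    [[t - 2/N, t - 1/N]]. The constant 3 ensures that the second ramp is still 0 before the first
    rise begins, and that the first is already 1 once the second rise is over. *)
Lemma test_function_plateau a b s t n : a <= s -> t <= b ->
  3 <= n.+1%:R * (t - s) -> test_function a b (plateau s t n).
Proof.
move=> sa tb Nst; have N0 : (0 : R) < n.+1%:R by rewrite ltr0n.
(* Off this closed interval the two ramps are both 0 or both 1, hence cancel. *)
have sub : closure [set x | plateau s t n x != 0] `<=`
    `[s + n.+1%:R^-1, t - n.+1%:R^-1]%classic.
  rewrite [X in _ `<=` X](closure_id _).1; last exact: interval_closed.
  apply: closure_subset => x /= /eqP; apply: contra_notP => /negP.
  rewrite in_itv/= negb_and -!ltNge /plateau /ramp => /orP[h|h].
  - have {}h : n.+1%:R * (x - s) < 1.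
      by rewrite -ltr_pdivlMl// mulr1 ltrBlDl.
    by rewrite !step_le0 ?subrr//; lra.
  - have {}h : n.+1%:R * (t - x) < 1.
      by rewrite -ltr_pdivlMl// mulr1 ltrBlDl -ltrBlDr.
    by rewrite !step_ge1 ?subrr//; lra.
have Ni : 0 < n.+1%:R^-1 :> R by rewrite invr_gt0.
split.
- by move=> k x; apply: smooth_expr_derivable_n; exact: smooth_plateau.
- apply: (subclosed_compact _ (@segment_compact _ (s + n.+1%:R^-1) (t - n.+1%:R^-1))) => //.
  exact: closed_closure.
- apply: (subset_trans sub) => x /=; rewrite !in_itv/= => /andP[h1 h2].
  move: Ni h1 h2; set i := _^-1 => Ni h1 h2.
  by rewrite (lt_le_trans _ h1) ?(le_lt_trans h2)//; lra.
Qed.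

(** At each point the sequence is eventually constant: the two rises shrink towards [s] and [t]
    while staying inside []s, t[], so the endpoints themselves get the value 0. *)
Lemma plateau_cvg s t x : s < t ->
  plateau s t n x @[n --> \oo] --> ((s < x < t)%R%:R : R).
Proof.
move=> st; apply: cvg_near_cst; have [xs|sx] := leP x s.
  near=> n.
  have h : 2 <= n.+1%:R * (t - x).
    near: n; apply: near_infty_mul_ge; rewrite subr_gt0; exact: le_lt_trans st.
  rewrite /plateau /ramp !step_le0 ?subrr//; first by lra.
  have : n.+1%:R * (x - s) <= 0 by rewrite mulr_ge0_le0// subr_le0.
  by lra.
have hs : \forall n \near \oo, 2 <= n.+1%:R * (x - s).
  by apply: near_infty_mul_ge; rewrite subr_gt0.
have [tx|xt] := leP t x.
  near=> n.
  have h : 2 <= n.+1%:R * (x - s) by near: n.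
  rewrite /plateau /ramp !step_ge1 ?subrr//; last by lra.
  have : 0 <= n.+1%:R * (x - t) by rewrite mulr_ge0// subr_ge0.
  by lra.
near=> n.
have h : 2 <= n.+1%:R * (x - s) by near: n.
have h' : 2 <= n.+1%:R * (t - x).
  by near: n; apply: near_infty_mul_ge; rewrite subr_gt0.
by rewrite /plateau /ramp step_ge1 ?step_le0 ?subr0//; lra.
Unshelve. all: end_near. Qed.

(** Each ramp averages [f] over a window shrinking to [s] or [t] from inside, so continuity on the
    closed interval suffices even when [s = a] or [t = b]. *)
Lemma plateau_derive1_cvg f a b s t : {within `[a, b], continuous f} ->
  mu.-integrable `]a, b[ (EFin \o f) -> a <= s -> s < t -> t <= b ->
  \int[mu]_(x in `]a, b[) (f x * derive1 (plateau s t n) x) @[n --> \oo]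
    --> f s - f t.
Proof.
move=> cf fi sa st tb.
have ab : a < b by lra.
have E n : \int[mu]_(x in `]a, b[) (f x * derive1 (plateau s t n) x) =
  \int[mu]_(x in `]a, b[) (f x * derive1 (ramp n.+1%:R (- (n.+1%:R * s) - 1)) x) -
  \int[mu]_(x in `]a, b[) (f x * derive1 (ramp n.+1%:R (- (n.+1%:R * t) + 2)) x).
  rewrite -RintegralB//.
  - by apply: eq_Rintegral => x _; rewrite plateau_derive1 mulrBr.
  - by apply: integrable_mul_continuous => //; [exact: ltW|exact: ramp_derive1_continuous].
  - by apply: integrable_mul_continuous => //; [exact: ltW|exact: ramp_derive1_continuous].
under eq_cvg do rewrite E.
have h3 : \forall n \near \oo, 3 <= n.+1%:R * (t - s).
  by apply: near_infty_mul_ge; rewrite subr_gt0.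
apply: cvgB; apply/cvgrPdist_le => e e0.
- have as_ : `[a, b]%classic s by rewrite /= in_itv/=; lra.
  have [d d0 fd] := within_continuous_dist cf as_ e0.
  near=> n.
  have h : 3 <= n.+1%:R * (t - s) by near: n.
  (* Points of the rise are at distance at most [2 / n.+1] from [s], hence strictly less than
     [d]. *)
  have h2 : 3 <= n.+1%:R * d by near: n; exact: near_infty_mul_ge.
  have N0 : (0 : R) < n.+1%:R by rewrite ltr0n.
  have hb : n.+1%:R * (t - s) <= n.+1%:R * (b - s) by rewrite ler_wpM2l; lra.
  have ha : n.+1%:R * (a - s) <= 0 by rewrite mulr_ge0_le0//; lra.
  rewrite distrC; apply: ramp_average => //; [lra|lra|].
  move=> x xab /andP[x1 x2]; apply: fd; first by rewrite /= in_itv/=; lra.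
  rewrite /ball/= distrC -(ltr_pM2l N0) -[X in X * `|_|]gtr0_norm// -normrM.
  by rewrite ltr_norml; lra.
- have at_ : `[a, b]%classic t by rewrite /= in_itv/=; lra.
  have [d d0 fd] := within_continuous_dist cf at_ e0.
  near=> n.
  have h : 3 <= n.+1%:R * (t - s) by near: n.
  have h2 : 3 <= n.+1%:R * d by near: n; exact: near_infty_mul_ge.
  have N0 : (0 : R) < n.+1%:R by rewrite ltr0n.
  have ha : n.+1%:R * (t - s) <= n.+1%:R * (t - a) by rewrite ler_wpM2l; lra.
  have hb : 0 <= n.+1%:R * (b - t) by rewrite mulr_ge0//; lra.
  rewrite distrC; apply: ramp_average => //; [lra|lra|].
  move=> x xab /andP[x1 x2]; apply: fd; first by rewrite /= in_itv/=; lra.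
  rewrite /ball/= distrC -(ltr_pM2l N0) -[X in X * `|_|]gtr0_norm// -normrM.
  by rewrite ltr_norml; lra.
Unshelve. all: end_near. Qed.

(** The weak identity is tested on plateaux: the side with [v] tends to the integral over []s, t[]
    by dominated convergence, and the side with [f] tends to [f s - f t]. The minus sign of
    integration by parts reverses the latter. *)
Lemma weak_derivative_increment f v a b s t : {within `[a, b], continuous f} ->
  mu.-integrable `]a, b[ (EFin \o f) -> mu.-integrable `]a, b[ (EFin \o v) ->
  weak_derivative a b f v -> a <= s -> s < t -> t <= b ->
  \int[mu]_(x in `]s, t[) v x = f t - f s.
Proof.
move=> cf fi vi fv sa st tb.
have ab : a <= b by lra.
have cP n : continuous (plateau s t n).
  exact/smooth_expr_continuous/smooth_plateau.
have mv : measurable_fun `]a, b[ v by apply/measurable_EFinP; exact: measurable_int vi.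
have mf n : measurable_fun `]a, b[ (fun x => v x * plateau s t n x).
  apply: measurable_funM => //.
  by apply: measurable_funTS; exact: continuous_measurable_fun.
have lim x : `]a, b[%classic x ->
    v x * plateau s t n x @[n --> \oo] --> (v \_ `]s, t[) x.
  move=> _; rewrite patchE mem_setE/= [_ \in _]in_itv/=.
  rewrite (_ : (if _ then _ else _) = v x * (s < x < t)%R%:R); last first.
    by case: ifP => _; rewrite ?mulr1// mulr0.
  by apply: cvgM; [exact: cvg_cst|exact: plateau_cvg].
have dom n x : `]a, b[%classic x -> `|v x * plateau s t n x| <= `|v x|.
  by move=> _; rewrite normrM ler_piMr// plateau_le1.
have mab : measurable `]a, b[%classic by [].
have [_] := Rintegral_dominated_convergence mab mf lim (integrable_abse vi) dom.
rewrite -Rintegral_mkcondr (_ : _ `&` _ = `]s, t[%classic); last first.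
  apply/seteqP; split => [x []//|x /= xst]; split => //=.
  by move: xst; rewrite !in_itv/=; lra.
move=> /cvgN h.
have := plateau_derive1_cvg cf fi sa st tb.
have -> : f s - f t = - (f t - f s) by rewrite opprB.
move=> h2; apply: oppr_inj; apply: (cvg_unique _ _ h2) => //.
apply: cvg_trans h; apply: near_eq_cvg; near=> n.
rewrite /= fv//; apply: test_function_plateau => //.
by near: n; apply: near_infty_mul_ge; rewrite subr_gt0.
Unshelve. all: end_near. Qed.

End WeakDerivative.

(** * Caputo derivatives at a minimum *)

Section Weight.
Context {R : realType}.
Notation mu := (@lebesgue_measure R).
Implicit Types (f g k v w : R -> R) (a b c s t x : R).

(** By the increment formula [f - f a] is the indefinite integral of [v], and Lebesgue
    differentiation applies. *)
Lemma weak_derivative_ae f v a b : a < b -> {within `[a, b], continuous f} ->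
  mu.-integrable `]a, b[ (EFin \o f) -> mu.-integrable `]a, b[ (EFin \o v) ->
  weak_derivative a b f v ->
  {ae mu, forall x, a < x < b -> derive1 f x = v x}.
Proof.
move=> ab cf fi vi fv.
(* Extension by zero gives a function integrable on the whole line, to which the fundamental theorem
   applies. *)
pose w := v \_ `]a, b[.
have wi : mu.-integrable setT (EFin \o w).
  by rewrite /w -restrict_EFin; apply/(integrable_mkcond _ _).1.
have locw : locally_integrable [set: R] w.
  by apply: open_integrable_locally => //; exact: openT.
have wiy y : mu.-integrable [set` Interval (BRight a) (BRight y)] (EFin \o w).
  by apply: integrableS wi => //; exact: measurable_itv.
have := FTC1 wiy locw.
apply: filterS; first exact: (ae_filter_ringOfSetsType mu).
move=> x /= + /andP[ax xb]; move=> /(_ ax).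
set F := (fun y => _) => -[dF FE].
have <- : w x = v x by rewrite /w patchE ifT// inE/= in_itv/= ax.
(* Only a neighbourhood of [x] inside []a, b[] matters, and there [f] coincides with [F] plus a
   constant. *)
rewrite -FE derive1E (@near_eq_derive _ R R _ (F \+ cst (f a))).
  by rewrite deriveD// derive_cst addr0 derive1E.
near=> y; have ay : a < y by near: y; exact: lt_nbhsr.
have yb : y < b by near: y; exact: lt_nbhsl.
rewrite /F/= -Rintegral_itv_bndo_bndc; last first.
  by apply: integrableS (wiy y) => //; apply: subset_itvl; rewrite bnd_simp.
rewrite (_ : \int[mu]_(_ in _) _ = f y - f a) ?subrK//.
rewrite -(weak_derivative_increment cf fi vi fv (lexx a) ay (ltW yb)).
apply: eq_Rintegral => z; rewrite inE/= in_itv/= => /andP[az zy].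
by rewrite /w patchE ifT// inE/= in_itv/= az (lt_trans zy).
Unshelve. all: end_near. Qed.


(** Counts the layers lying below a level; this turns a sum of indicators of superlevel sets into a
    truncated integer part. *)
Lemma sum_ltn_minn (M m : nat) : (\sum_(j < M) (j < m)%N = minn M m)%N.
Proof.
elim: M => [|M IH]; first by rewrite big_ord0 min0n.
by rewrite big_ord_recr/= IH; case: ltnP => h; rewrite ?addn1 ?addn0;
  [rewrite (minn_idPl h)|rewrite (minn_idPr (leqW h))].
Qed.

(** A superlevel set of a nondecreasing function is closed upwards, hence is a tail starting at its
    infimum; the bracket depends on whether the infimum belongs to the set. *)
Lemma superlevel_tail k a b c :
  {in `]a, b[ &, {homo k : x y / x <= y}} ->
  let U := `]a, b[%classic `&` [set x | c <= k x] in
  U = set0 \/ exists2 s, a <= s < b & U = `]s, b[%classic \/ U = `[s, b[%classic.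
Proof.
move=> nk U; have [->|/set0P U0] := eqVneq U set0; [by left|right].
have Ua : lbound U a by move=> x [/= + _]; rewrite in_itv/= => /andP[/ltW].
have hU : has_inf U by split => //; exists a.
have upU x y : U x -> x <= y -> y < b -> U y.
  move=> [/= xab cx] xy yb.
  have yab : y \in `]a, b[.
    by move: xab; rewrite !in_itv/= yb andbT => /andP[/lt_le_trans->].
  by split => //=; apply: le_trans cx _; exact: nk.
have sb : inf U < b.
  case: U0 => u Uu; apply: (le_lt_trans (ge_inf hU.2 Uu)).
  by case: Uu => /=; rewrite in_itv/= => /andP[].
have tl x : inf U < x -> x < b -> U x.
  move=> sx xb; have [||u Uu ux] := @inf_adherent _ U (x - inf U) => //.
    by rewrite subr_gt0.
  by apply: upU Uu _ xb; apply: ltW; rewrite subrKC in ux.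
exists (inf U); first by rewrite sb andbT lb_le_inf.
have [Us|nUs] := pselect (U (inf U)); [right|left]; apply/seteqP; split => x /=.
- move=> Ux; rewrite in_itv/= (ge_inf hU.2 Ux)/=.
  by case: Ux => /=; rewrite in_itv/= => /andP[].
- by rewrite in_itv/= => /andP[sx xb]; exact: upU Us sx xb.
- move=> Ux; rewrite in_itv/= lt_neqAle (ge_inf hU.2 Ux)/= andbT.
  apply/andP; split; last by case: Ux => /=; rewrite in_itv/= => /andP[].
  by apply/eqP => sx; apply: nUs; rewrite sx.
- by rewrite in_itv/= => /andP[sx xb]; exact: tl.
Qed.

(** A layer-cake argument: [k] is a limit of positive combinations of indicators of its superlevel
    sets. These are tails of the interval, over which [w] has a nonpositive integral. *)
Lemma Rintegral_nondecreasing_weight k w a b :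
  {in `]a, b[ &, {homo k : x y / x <= y}} -> (forall x, a < x < b -> 0 <= k x) ->
  mu.-integrable `]a, b[ (EFin \o w) ->
  mu.-integrable `]a, b[ (EFin \o (fun x => k x * w x)) ->
  (forall s, a <= s < b -> \int[mu]_(x in `]s, b[) w x <= 0) ->
  \int[mu]_(x in `]a, b[) (k x * w x) <= 0.
Proof.
move=> nk k0 wi kwi w0.
pose U c := `]a, b[%classic `&` [set x | c <= k x].
have tlU c : U c = set0 \/
    exists2 s, a <= s < b & U c = `]s, b[%classic \/ U c = `[s, b[%classic.
  exact: superlevel_tail.
have mU c : measurable (U c).
  case: (tlU c) => [->//|[s _ [->|->]]]; exact: measurable_itv.
have wiU c : mu.-integrable `]a, b[ (EFin \o (w \_ (U c))).
  rewrite -restrict_EFin; apply/integrable_restrict => //; first exact: mU.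
  by apply: integrableS wi => //; apply: measurableI => //; exact: mU.
have IU c : \int[mu]_(x in `]a, b[) (w \_ (U c)) x <= 0.
  rewrite -Rintegral_mkcondr setIA setIid -/(U c).
  case: (tlU c) => [->|[s sab [->|E]]]; first by rewrite Rintegral_set0.
    exact: w0.
  rewrite E -Rintegral_itv_obnd_cbnd; first exact: w0.
  apply: integrableS wi => //; apply: (@subset_trans _ `[s, b[%classic).
    by apply: subset_itvr; rewrite bnd_simp.
  by rewrite -E; exact: subIsetl.
(* [F n] is [w] times [k] rounded down to a multiple of [1/(n+1)] and cut at [n+1]. *)
pose F n x := \sum_(j < n.+1 * n.+1) n.+1%:R^-1 * (w \_ (U (j.+1%:R / n.+1%:R))) x.
have FP n : mu.-integrable `]a, b[ (EFin \o F n) /\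
    \int[mu]_(x in `]a, b[) F n x <= 0.
  rewrite /F; elim: (n.+1 * n.+1)%N => [|M [IH1 IH2]].
    rewrite (_ : (fun x => _) = cst 0); last by apply/funext => x; rewrite big_ord0.
    by split; [exact: integrable0|rewrite Rintegral_cst// mul0r].
  rewrite (_ : (fun x => _) = 
      (fun x => \sum_(j < M) n.+1%:R^-1 * (w \_ (U (j.+1%:R / n.+1%:R))) x +
    n.+1%:R^-1 * (w \_ (U (M.+1%:R / n.+1%:R))) x)); last first.
    by apply/funext => x; rewrite big_ord_recr.
  have hZ : mu.-integrable `]a, b[
      (EFin \o (fun x => n.+1%:R^-1 * (w \_ (U (M.+1%:R / n.+1%:R))) x)).
    by have := @integrableZl _ _ _ mu _ _ (n.+1%:R^-1 : R) _ (wiU (M.+1%:R / n.+1%:R)); apply.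
  split; first by have := @integrableD _ _ _ mu _ _ _ _ IH1 hZ; apply.
  rewrite RintegralD// RintegralZl//.
  by rewrite -[leRHS]addr0 lerD// mulr_ge0_le0.
(* Layer [j] contributes exactly when [j.+1 <= n.+1 * k x], so the number of active layers is the
   integer part of [n.+1 * k x], cut at the total number of layers. *)
have FE n x : a < x < b -> F n x =
    (minn (n.+1 * n.+1) (Num.truncn (n.+1%:R * k x)))%:R / n.+1%:R * w x.
  move=> xab; rewrite -sum_ltn_minn natr_sum /F mulr_suml mulr_suml.
  apply: eq_bigr => j _; rewrite truncn_gt_nat patchE.
  have -> : (x \in U (j.+1%:R / n.+1%:R)) = (j.+1%:R <= n.+1%:R * k x).
    apply/idP/idP => [|h].
      by rewrite inE => -[_ /=]; rewrite ler_pdivrMr// mulrC.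
    by rewrite inE; split; rewrite /= ?in_itv//= ler_pdivrMr// mulrC.
  by case: ifP => _; rewrite ?mul1r// mulr0 !mul0r.
(* Since [k] is nonnegative, rounding it down and cutting it can only decrease the absolute value of
   the product. *)
have bnd n x : `]a, b[%classic x -> `|F n x| <= `|k x * w x|.
  rewrite /= in_itv/= => xab; rewrite FE// !normrM ler_wpM2r//.
  rewrite [leRHS]ger0_norm ?k0// -normrM ger0_norm// ler_pdivrMr// [leRHS]mulrC.
  apply: (@le_trans _ _ (Num.truncn (n.+1%:R * k x))%:R).
    by rewrite ler_nat geq_minr.
  by rewrite truncn_le mulr_ge0// k0.
have lim x : `]a, b[%classic x -> F n x @[n --> \oo] --> k x * w x.
  rewrite /= in_itv/= => xab; under eq_cvg do rewrite FE//.
  apply: cvgM; last exact: cvg_cst.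
  apply/cvgrPdist_le => e e0; near=> n.
  (* The rounding error is at most [1 / n.+1], which is below [e]; the next bound makes the cut at
     [n.+1] ineffective at [x]. *)
  have h1 : 1 <= n.+1%:R * e by near: n; exact: near_infty_mul_ge.
  have h2 : k x <= n.+1%:R * 1 by near: n; exact: near_infty_mul_ge.
  have N0 : (0 : R) < n.+1%:R by rewrite ltr0n.
  have y0 : 0 <= n.+1%:R * k x by rewrite mulr_ge0// k0.
  rewrite (minn_idPr _); last first.
    rewrite -(ler_nat R); apply: le_trans (_ : n.+1%:R * k x <= _).
      by rewrite truncn_le.
    by rewrite natrM ler_pM2l// -[leRHS]mulr1.
  have /andP[t1 t2] := truncn_itv y0.
  rewrite -(ler_pM2l N0) -[X in X * `|_|]gtr0_norm// -normrM.
  rewrite mulrBr mulrCA divff ?gt_eqF// mulr1.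
  rewrite ger0_norm ?subr_ge0//; apply: le_trans h1.
  by rewrite lerBlDr addrC natr1 ltW.
have mab : measurable `]a, b[%classic by [].
have mF n : measurable_fun `]a, b[ (F n).
  by apply/measurable_EFinP; apply: measurable_int (FP n).1.
have [_ H] := Rintegral_dominated_convergence mab mF lim (integrable_abse kwi) bnd.
rewrite -(cvg_lim _ H)//; apply: limr_le; first by apply/cvg_ex; eexists; exact: H.
by apply: nearW => n; case: (FP n).
Unshelve. all: end_near. Qed.

End Weight.

(** * Power kernels and positivity of the Gamma function on []0, 1]] *)

Section Caputo.
Context {R : realType}.
Notation mu := (@lebesgue_measure R).
Implicit Types (f g k v w : R -> R) (a b c s t x z alpha : R).

Lemma le_powRN alpha x y : 0 <= alpha -> 0 < x -> x <= y ->
  y `^ (- alpha) <= x `^ (- alpha).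
Proof.
move=> a0 x0 xy; have y0 := lt_le_trans x0 xy.
rewrite !powRN lef_pV2 ?posrE ?powR_gt0//.
by apply: ge0_ler_powR => //; rewrite nnegrE ltW.
Qed.

(** Away from 0 the antiderivative [z^-1 * x ^ z] bounds the integral by [z^-1]; monotone
    convergence carries the bound to the singular endpoint. *)
Lemma integral_powR_itv01 z : 0 < z ->
  (\int[mu]_(x in `]0%R, 1%R[) (x `^ (z - 1))%:E < +oo)%E.
Proof.
move=> z0.
(* The shift to [n.+2] keeps every interval nondegenerate, including the first. *)
pose F n := `[n.+2%:R^-1 : R, 1]%classic.
have I n : (\int[mu]_(x in F n) (x `^ (z - 1))%:E <= (z^-1)%:E)%E.
  have n0 : 0 < n.+2%:R^-1 :> R by rewrite invr_gt0.
  have n1 : n.+2%:R^-1 < 1 :> R by rewrite invf_lt1// ltr1n.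
  have d (y : R) : 0 < y -> is_derive y 1 (fun x => z^-1 * x `^ z) (y `^ (z - 1)).
    move=> y0; have h := @is_derive1_powR R z y y0.
    have := is_deriveM (is_derive_cst (z^-1) y 1) h.
    by rewrite /GRing.scale/= mulr0 addr0 mulKf ?gt_eqF//.
  rewrite (@continuous_FTC2 _ _ (fun x => z^-1 * x `^ z))//.
  - rewrite powR1 mulr1 -EFinB lee_fin gerBl mulr_ge0// ?powR_ge0//.
    by rewrite invr_ge0 ltW.
  - apply: continuous_in_subspaceT => y; rewrite inE/= in_itv/= => /andP[y1 _].
    have y0 := lt_le_trans n0 y1.
    apply: differentiable_continuous; apply/derivable1_diffP.
    by apply: derivable_powR; rewrite in_itv/= y0.
  - have c (y : R) : 0 < y -> {for y, continuous (fun x => z^-1 * x `^ z)}.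
      move=> y0; apply: differentiable_continuous; apply/derivable1_diffP.
      by case: (d y y0).
    split.
    + move=> y; rewrite in_itv/= => /andP[y1 _].
      by case: (d y (lt_trans n0 y1)).
    + exact/cvg_at_right_filter/c.
    + exact/cvg_at_left_filter/c.
  - move=> y; rewrite in_itv/= => /andP[y1 _].
    by rewrite derive1E; case: (d y (lt_trans n0 y1)).
have mp (D : set R) : measurable_fun D (fun x => (x `^ (z - 1))%:E).
  by apply/measurable_EFinP; apply: measurable_funTS; exact: measurable_powR.
have ndF : {homo F : n m / (n <= m)%N >-> (n <= m)%O}.
  move=> m n mn; apply/subsetPset => x; rewrite /F /= !in_itv/= => /andP[h ->].
  by rewrite andbT; apply: le_trans h; rewrite lef_pV2 ?posrE// ler_nat !ltnS.
have p0 x : (0 <= (x `^ (z - 1))%:E)%E by rewrite lee_fin powR_ge0.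
have H : (\int[mu]_(x in F n) (x `^ (z - 1))%:E)%E @[n --> \oo] -->
    (\int[mu]_(x in \bigcup_n F n) (x `^ (z - 1))%:E)%E.
  apply: ge0_nondecreasing_set_cvg_integral => //.
  by move=> n; exact: measurable_itv.
  by move=> n; exact: mp.
apply: (@Order.POrderTheory.le_lt_trans _ _ (z^-1%:E)); last exact: ltry.
apply: (@le_trans _ _ (\int[mu]_(x in \bigcup_n F n) (x `^ (z - 1))%:E)%E).
  apply: ge0_subset_integral => //.
  - by apply: bigcup_measurable => n _; exact: measurable_itv.
  - exact: mp.
  - move=> x; rewrite /= in_itv/= => /andP[x0 x1].
    exists (Num.truncn (x^-1)) => //; rewrite /F /= in_itv/= (ltW x1) andbT.
    rewrite -[leRHS]invrK lef_pV2 ?posrE ?invr_gt0// ltW//.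
    by apply: lt_trans (truncnS_gt _) _; rewrite ltr_nat.
rewrite -(cvg_lim _ H)//; apply: lime_le; first by apply/cvg_ex; eexists; exact: H.
exact: nearW.
Qed.

Lemma integral_expRN_itv1y : (\int[mu]_(x in `[1%R, +oo[) (expR (- x))%:E < +oo)%E.
Proof.
have d (y : R) : is_derive y 1 (fun x => - expR (- x)) (expR (- y)).
  have h : is_derive y 1 (fun x => - x) (-1) := is_deriveN (is_derive_id _ _).
  have := is_deriveN (@is_derive1_comp _ expR (fun x => - x) y _ _ (is_derive_expR _) h).
  by rewrite mulrN1 opprK.
have c : continuous (fun x : R => expR (- x)).
  by move=> x; apply: continuous_comp; [exact: opp_continuous|exact: continuous_expR].
rewrite (@ge0_continuous_FTC2y _ _ (fun x => - expR (- x)) 1 0)//.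
- by rewrite -EFinB ltry.
- exact: continuous_subspaceT.
- by rewrite -oppr0; apply: cvgN; exact: cvgr_expR.
- by apply: cvg_at_right_filter; apply: cvgN; exact: c.
- by move=> x _; rewrite derive1E; case: (d x).
Qed.

(** [Gamma] is the [fine] part of an extended integral, which would be 0 if the integral diverged,
    so finiteness has to be proved as well. The integrand is dominated by the power on []0, 1[] and,
    as [z <= 1], by the exponential on [[1, +oo[]. *)
Lemma Gamma_gt0 z : 0 < z -> z <= 1 -> 0 < Gamma z.
Proof.
move=> z0 z1; rewrite /Gamma /Rintegral.
pose h (s : R) := (s `^ (z - 1) * expR (- s))%:E.
rewrite -[X in fine X]/(\int[mu]_(x in `]0%R, +oo[) h x)%E.
have h0 x : (0 <= h x)%E by rewrite lee_fin mulr_ge0 ?powR_ge0 ?expR_ge0.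
have mpow : measurable_fun setT (fun x => x `^ (z - 1)) by exact: measurable_powR.
have mexp : measurable_fun setT (fun x => expR (- x) : R).
  by apply: continuous_measurable_fun => x; apply: continuous_comp;
    [exact: opp_continuous|exact: continuous_expR].
have mh D : measurable_fun D h.
  apply/measurable_EFinP; apply: measurable_funTS; exact: measurable_funM.
apply: fine_gt0; apply/andP; split.
  (* On []0, 1[] the power is at least 1 and the exponential at least [expR (-1)]. *)
  apply: (@lt_le_trans _ _ (\int[mu]_(x in `]0%R, 1%R[) (expR (-1))%:E)%E).
    rewrite integral_cst//= lebesgue_measure_itv/= lte_fin ltr01 oppr0 adde0 mule1.
    by rewrite lte_fin expR_gt0.
  apply: (@le_trans _ _ (\int[mu]_(x in `]0%R, 1%R[) h x)%E).
    apply: ge0_le_integral => //.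
    - exact: mh.
    - move=> x; rewrite /= in_itv/= => /andP[x0 x1]; rewrite lee_fin -[leLHS]mul1r.
      rewrite ler_pM ?expR_ge0// ?ler_expR ?lerN2 ?(ltW x1)//.
      have := @le_powRN (1 - z) x 1; rewrite powR1 opprB subr_ge0.
      by apply => //; exact: ltW.
  by apply: ge0_subset_integral => //; [exact: mh|apply: subset_itvl; rewrite bnd_simp].
rewrite (_ : `]0, +oo[%classic = `]0, 1[%classic `|` `[1, +oo[%classic); last first.
  by rewrite -itv_bndbnd_setU// bnd_simp.
have dj : [disjoint `]0 : R, 1[ & `[1 : R, +oo[]%classic.
  apply/disj_setPS => x /= []; rewrite !in_itv/= => /andP[_ x1] /andP[x2 _].
  by move: (lt_le_trans x1 x2); rewrite ltxx.
have -> : (\int[mu]_(x in `]0%R, 1%R[ `|` `[1%R, +oo[) h x =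
    \int[mu]_(x in `]0%R, 1%R[) h x + \int[mu]_(x in `[1%R, +oo[) h x)%E.
  by apply: ge0_integral_setU => //; exact: mh.
apply: lte_add_pinfty.
  apply: le_lt_trans (integral_powR_itv01 z0); apply: ge0_le_integral => //.
  - exact: mh.
  - by apply/measurable_EFinP; exact: measurable_funTS.
  - move=> x; rewrite /= in_itv/= => /andP[x0 _].
    by rewrite lee_fin ler_piMr ?powR_ge0// expR_le1 oppr_le0 ltW.
apply: le_lt_trans integral_expRN_itv1y; apply: ge0_le_integral => //.
- exact: mh.
- by apply/measurable_EFinP; exact: measurable_funTS.
- move=> x; rewrite /= in_itv/= andbT => x1.
  rewrite lee_fin ler_piMl ?expR_ge0//.
  have := @le_powRN (1 - z) 1 x; rewrite powR1 opprB subr_ge0.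
  by apply.
Qed.

End Caputo.

(** * The Caputo inequality for a difference of two functions *)

Section Compare.
Context {R : realType}.
Notation mu := (@lebesgue_measure R).
Implicit Types (f g k v w : R -> R) (a b c e s t x z alpha T : R).

(** Replacing the pointwise derivative by the weak one changes the integrand on a null set only. The
    gain is that [v] has known integrals over intervals. *)
Lemma caputo_kernel_weak alpha f v T t : 0 < t -> t <= T ->
  mu.-integrable `]0, T[ (EFin \o v) ->
  {ae mu, forall x, 0 < x < T -> derive1 f x = v x} ->
  mu.-integrable `]0, t[ (EFin \o caputo_kernel alpha f t) ->
  mu.-integrable `]0, t[ (EFin \o (fun s => (t - s) `^ (- alpha) * v s)) /\
  \int[mu]_(s in `]0, t[) caputo_kernel alpha f t s =
  \int[mu]_(s in `]0, t[) ((t - s) `^ (- alpha) * v s).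
Proof.
move=> t0 tT vi aev ki.
have sub : `]0, t[ `<=` `]0, T[ by apply: subset_itvl; rewrite bnd_simp.
have vit : mu.-integrable `]0, t[ (EFin \o v) by exact: integrableS vi.
have mv : measurable_fun `]0, t[ v by apply/measurable_EFinP; exact: measurable_int vit.
have mk : measurable_fun setT (fun s => (t - s) `^ (- alpha)).
  apply: (measurableT_comp (measurable_powR _)).
  by apply: continuous_measurable_fun => x; apply: cvgB; [exact: cvg_cst|exact: cvg_id].
have mkv : measurable_fun `]0, t[ (EFin \o (fun s => (t - s) `^ (- alpha) * v s)).
  by apply/measurable_EFinP; apply: measurable_funM => //; exact: measurable_funTS.
have mker := measurable_int _ ki.
have ae : {ae mu, forall s, `]0, t[%classic s ->
    caputo_kernel alpha f t s = (t - s) `^ (- alpha) * v s}.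
  move: aev; apply: filterS; first exact: (ae_filter_ringOfSetsType mu).
  move=> x /= h; rewrite in_itv/= => /andP[x0 xt].
  by rewrite /caputo_kernel h// x0 (lt_le_trans xt).
split; last first.
  congr fine; apply: ae_eq_integral => //.
  move: ae; apply: filterS; first exact: (ae_filter_ringOfSetsType mu).
  by move=> x /= h /h ->.
apply/integrableP; split => //.
have /integrableP[_] := ki; congr (_ < _)%E; apply: ae_eq_integral => //.
- exact: measurableT_comp.
- exact: measurableT_comp.
- move: ae; apply: filterS; first exact: (ae_filter_ringOfSetsType mu).
  by move=> x /= h /h ->.
Qed.

(* Stated for two functions because [derive1] is additive only where both of
   them are differentiable. *)
Lemma caputo_le alpha f1 f2 T t e : 0 < alpha <= 1 -> 0 < t -> t < T ->
  {within `[0, T], continuous f1} -> {within `[0, T], continuous f2} ->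
  W11 0 T f1 -> W11 0 T f2 ->
  caputo_exists alpha f1 t -> caputo_exists alpha f2 t -> 0 <= e ->
  (forall s, 0 <= s <= t -> f1 t - f2 t + e * (t - s) <= f1 s - f2 s) ->
  exists2 C, 0 < C & caputo alpha f1 t + C * e <= caputo alpha f2 t.
Proof.
move=> /andP[a0 a1] t0 tT cf1 cf2 [fi1 [v1 vi1 fv1]] [fi2 [v2 vi2 fv2]].
rewrite /caputo_exists /caputo; have [aa|aa] := ltP alpha 1; last first.
  (* Case [alpha = 1]: the hypothesis controls earlier times only, so the derivative of [f1 - f2] is
     computed from left difference quotients, each at most [- e]. *)
  move=> d1 d2 e0 H; exists 1 => //; rewrite mul1r.
  have dB := derivableB d1 d2.
  rewrite -lerBrDl -lerN2 opprB !derive1E -deriveB//.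
  have dl := @cvg_at_leftE R R
    (fun h => h^-1 *: (((f1 - f2) \o shift t) (h *: 1) - (f1 - f2) t)) 0 dB.
  rewrite /derive dl; apply: limr_le.
    by have /cvg_ex[l hl] := dB; apply/cvg_ex; exists l; exact: cvg_dnbhs_at_left hl.
  near=> h.
  have h0 : h < 0 by near: h; exact: nbhs_left_lt.
  have ht : - t < h by near: h; apply: nbhs_left_gt; rewrite oppr_lt0.
  rewrite -[h *: 1]/(h * 1) mulr1 -[X in X <= _]/(_ * _) mulrC ler_ndivrMr// mulNr.
  have /H /= : 0 <= h + t <= t by lra.
  rewrite !fctE. lra.
move=> k1 k2 e0 H.
have T0 : 0 < T by exact: lt_trans tT.
have ae1 := weak_derivative_ae T0 cf1 fi1 vi1 fv1.
have ae2 := weak_derivative_ae T0 cf2 fi2 vi2 fv2.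
have [ki1 ->] := caputo_kernel_weak t0 (ltW tT) vi1 ae1 k1.
have [ki2 ->] := caputo_kernel_weak t0 (ltW tT) vi2 ae2 k2.
have sub s : 0 <= s -> `]s, t[ `<=` `]0, T[.
  by move=> s0; apply: subset_itvW => //; exact: ltW.
have it s v : 0 <= s -> mu.-integrable `]0, T[ (EFin \o v) ->
    mu.-integrable `]s, t[ (EFin \o v).
  by move=> s0 vi; apply: integrableS vi => //; exact: sub.
have G0 : 0 < (Gamma (1 - alpha))^-1 by rewrite invr_gt0 Gamma_gt0//; lra.
have c0 : 0 < t `^ (- alpha) by rewrite powR_gt0.
(* The product with [e] is the normalised kernel value at 0 times [e * t], the guaranteed drop of
   [f1 - f2] between 0 and [t]. *)
exists ((Gamma (1 - alpha))^-1 * (t `^ (- alpha) * t)); first by rewrite !mulr_gt0.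
rewrite -mulrA -mulrDr ler_pM2l//.
set I1 := Rintegral _ _ _; set I2 := Rintegral _ _ _.
(* The kernel splits into its value at 0, a constant that integrates to a multiple of the total
   increment and provides the gain, and this nonnegative nondecreasing remainder. *)
pose k s := (t - s) `^ (- alpha) - t `^ (- alpha).
pose w s := v1 s - v2 s.
have wi s : 0 <= s -> mu.-integrable `]s, t[ (EFin \o w).
  by move=> s0; have := @integrableB _ _ _ mu _ _ _ _ (it s _ s0 vi1) (it s _ s0 vi2); apply.
have wI s : 0 <= s -> s < t ->
    \int[mu]_(x in `]s, t[) w x = (f1 t - f2 t) - (f1 s - f2 s).
  move=> s0 st; rewrite RintegralB//; [|exact: it|exact: it].
  rewrite (weak_derivative_increment cf1 fi1 vi1 fv1) ?(ltW tT)//.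
  rewrite (weak_derivative_increment cf2 fi2 vi2 fv2) ?(ltW tT)//.
  by ring.
have kwi : mu.-integrable `]0, t[ (EFin \o (fun s => (t - s) `^ (- alpha) * w s)).
  have := @integrableB _ _ _ mu _ _ _ _ ki1 ki2 => /(_ (measurable_itv _)).
  by apply: eq_integrable => // s _; rewrite /= -EFinB mulrBr.
have cwi : mu.-integrable `]0, t[ (EFin \o (fun s => t `^ (- alpha) * w s)).
  by have := @integrableZl _ _ _ mu _ _ (t `^ (- alpha)) _ (wi 0 (lexx _)); apply.
have key : \int[mu]_(s in `]0, t[) (k s * w s) <= 0.
  apply: Rintegral_nondecreasing_weight.
  - move=> x y; rewrite !in_itv/= => /andP[x0 xt] /andP[y0 yt] xy.
    by rewrite lerB// le_powRN ?subr_gt0//; lra.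
  - by move=> x /andP[x0 xt]; rewrite subr_ge0 le_powRN ?subr_gt0//; lra.
  - exact: wi.
  - have := @integrableB _ _ _ mu _ _ _ _ kwi cwi => /(_ (measurable_itv _)).
    by apply: eq_integrable => // s _; rewrite /= -EFinB mulrBl.
  - move=> s /andP[s0 st]; rewrite wI//.
    have := H s; rewrite s0 ltW// => /(_ isT).
    have : 0 <= e * (t - s) by rewrite mulr_ge0//; lra.
    lra.
have kE : \int[mu]_(s in `]0, t[) (k s * w s) =
    I1 - I2 - t `^ (- alpha) * ((f1 t - f2 t) - (f1 0 - f2 0)).
  rewrite -wI// -RintegralZl//; last exact: wi.
  rewrite /I1 /I2 -RintegralB//.
  rewrite -RintegralB//; last first.
    by have := @integrableB _ _ _ mu _ _ _ _ ki1 ki2; apply.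
  by apply: eq_Rintegral => s _; rewrite /k /w; ring.
move: key; rewrite kE => key.
have := H 0; rewrite lexx ltW// subr0 => /(_ isT) H0.
have : t `^ (- alpha) * (e * t) <= t `^ (- alpha) * ((f1 0 - f2 0) - (f1 t - f2 t)).
  by rewrite ler_pM2l//; lra.
by lra.
Unshelve. all: end_near. Qed.

End Compare.

(** * Comparison of solutions *)

Section Sections.
Context {R : realType}.
Implicit Types (l T x t : R).

Lemma within_continuous_comp (U V : topologicalType) (W : topologicalType)
    (A : set U) (B : set V) (f : U -> W) (phi : V -> U) :
  {within A, continuous f} -> continuous phi -> (forall s, B s -> A (phi s)) ->
  {within B, continuous (f \o phi)}.
Proof.
move=> /subspace_continuousP cf cphi BA; apply/subspace_continuousP => s Bs.
apply: cvg_comp (cf _ (BA _ Bs)) => P /= /(cphi s) H.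
have {}H : \forall y \near s, A (phi y) -> P (phi y) := H.
suff : \forall y \near s, B y -> P (phi y) by [].
by apply: filterS H => y Ay By; apply: Ay; exact: BA.
Qed.

Lemma rect_section_time l T (f : R -> R -> R) x : continuous_on_rect l T f ->
  0 <= x <= l -> {within `[0, T], continuous f x}.
Proof.
move=> cf xl; apply: (within_continuous_comp (phi := fun t => (x, t)) cf).
  by move=> t; apply: (@cvg_pair _ _ _ (nbhs t) (nbhs x) (nbhs t));
    [exact: cvg_cst|exact: cvg_id].
by move=> t /=; rewrite in_itv.
Qed.

Lemma rect_section_space l T (f : R -> R -> R) t : continuous_on_rect l T f ->
  0 <= t <= T -> {within `[0, l], continuous (fun x => f x t)}.
Proof.
move=> cf tT; apply: (within_continuous_comp (phi := fun x => (x, t)) cf).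
  by move=> x; apply: (@cvg_pair _ _ _ (nbhs x) (nbhs x) (nbhs t));
    [exact: cvg_id|exact: cvg_cst].
by move=> x /=; rewrite in_itv.
Qed.

(** Equations and data are given on open intervals only; this carries signs to the closed ones. *)
Lemma within_continuous_ge0 (f : R -> R) (a b : R) : a < b ->
  {within `[a, b], continuous f} -> (forall x, a < x < b -> 0 <= f x) ->
  forall x, a <= x <= b -> 0 <= f x.
Proof.
move=> ab cf f0 x /andP[ax xb]; rewrite leNgt; apply/negP => fx.
have xab : `[a, b]%classic x by rewrite /= in_itv/= ax.
have e0 : 0 < - f x / 2 by lra.
have [d d0 fd] := within_continuous_dist cf xab e0.
have nf y : a < y < b -> `|x - y| < d -> False.
  move=> yab xy; have := f0 _ yab.
  have := fd y; rewrite /= in_itv/= /ball/= => /(_ _ xy).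
  have -> : a <= y <= b by lra.
  by move=> /(_ isT); rewrite ler_norml => ?; lra.
(* Half the minimum puts both [a + r] and [b - r] strictly inside the interval and within [d] of the
   corresponding endpoint. *)
pose r := Num.min d (b - a) / 2.
have [rd rb r0] : [/\ r < d, r < b - a & 0 < r].
  have h : 0 < Num.min d (b - a) by rewrite lt_min d0 subr_gt0.
  have h1 : Num.min d (b - a) <= d by rewrite ge_min lexx.
  have h2 : Num.min d (b - a) <= b - a by rewrite ge_min lexx orbT.
  by rewrite /r; split; lra.
have [xa|xa] := eqVneq x a.
  by apply: (nf (a + r)); [lra|rewrite xa opprD addNKr normrN gtr0_norm].
have [xb'|xb'] := eqVneq x b.
  by apply: (nf (b - r)); [lra|rewrite xb' subKr gtr0_norm].
apply: (nf x); last by rewrite subrr normr0.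
by rewrite !lt_neqAle ax xb xb' eq_sym xa.
Qed.

End Sections.

(** Equality would annihilate each nonnegative term [p i * (d i - c i)], hence every weight, against
    the positivity of their sum. *)
Lemma ltr_sum_weighted {R : realDomainType} n (p c d : 'I_n -> R) :
  (forall i, 0 <= p i) -> 0 < \sum_(i < n) p i -> (forall i, c i < d i) ->
  \sum_(i < n) p i * c i < \sum_(i < n) p i * d i.
Proof.
move=> p0 sp cd; rewrite -subr_gt0 -sumrB lt_neqAle eq_sym.
have h i : 0 <= p i * d i - p i * c i by rewrite -mulrBr mulr_ge0// subr_ge0 ltW.
rewrite sumr_ge0// andbT; apply: contraTneq sp => s0.
rewrite big1 ?ltxx// => i _; have /eqP := s0; rewrite psumr_eq0// => /allP/(_ i).
rewrite mem_index_enum => /(_ isT)/=; rewrite -mulrBr mulf_eq0 subr_eq0.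
by rewrite (gt_eqF (cd i)) orbF => /eqP.
Qed.

(** Common core of both claims: zeroth-order coefficients and sources enter only through a
    comparison of right-hand sides, required just at the points where the desired inequality
    fails. *)
Lemma comparison_principle (R : realType) (l T : R) (n m : nat)
    (alpha : 'I_n -> R) (beta : 'I_m -> R)
    (p : 'I_n -> R -> R -> R) (q : 'I_m -> R -> R -> R)
    (r1 r2 F1 F2 : R -> R -> R) (a1 a2 g1 g2 : R -> R) (u1 u2 : R -> R -> R) :
  0 < l -> 0 < T ->
  (forall i, 0 < alpha i <= 1) -> (forall j, 0 < beta j <= 1) ->
  (forall i x t, 0 < x < l -> 0 < t < T -> 0 <= p i x t) ->
  (forall j x t, 0 < x < l -> 0 < t < T -> 0 <= q j x t) ->
  (forall x t, 0 < x < l -> 0 < t < T -> 0 < \sum_(i < n) p i x t) ->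
  (forall t, 0 < t < T -> g2 t <= g1 t) ->
  (forall x, 0 < x < l -> a2 x <= a1 x) ->
  is_solution l T alpha beta p q r1 a1 g1 F1 u1 ->
  is_solution l T alpha beta p q r2 a2 g2 F2 u2 ->
  (forall x t, 0 < x < l -> 0 < t < T -> u1 x t < u2 x t ->
    r2 x t * u2 x t + F2 x t <= r1 x t * u1 x t + F1 x t) ->
  forall x t, 0 <= x <= l -> 0 <= t <= T -> u2 x t <= u1 x t.
Proof.
move=> l0 T0 halpha hbeta p0 q0 sp g12 a12 s1 s2 rhs.
have cu1 := sol_continuous s1; have cu2 := sol_continuous s2.
pose w x t := u1 x t - u2 x t.
have cwt x : 0 <= x <= l -> {within `[0, T], continuous w x}.
  move=> xl; have c1 := rect_section_time cu1 xl; have c2 := rect_section_time cu2 xl.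
  by move=> t; apply: cvgB; [exact: c1|exact: c2].
have cwx t : 0 <= t <= T -> {within `[0, l], continuous (fun x => w x t)}.
  move=> tT; have c1 := rect_section_space cu1 tT; have c2 := rect_section_space cu2 tT.
  by move=> x; apply: cvgB; [exact: c1|exact: c2].
have w0t t : 0 <= t <= T -> 0 <= w 0 t.
  apply: (within_continuous_ge0 T0 (cwt 0 _)); first by rewrite lexx ltW.
  by move=> s sT; rewrite subr_ge0 (sol_boundary s1)// (sol_boundary s2)// g12.
have wx0 x : 0 <= x <= l -> 0 <= w x 0.
  apply: (within_continuous_ge0 l0 (cwx 0 _)); first by rewrite lexx ltW.
  by move=> y yl; rewrite subr_ge0 (sol_initial s1)// (sol_initial s2)// a12.
(* Interior nonnegativity extends to the closed rectangle by continuity, first in time and then in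
   space. *)
suff winterior x t : 0 < x < l -> 0 < t < T -> 0 <= w x t.
  have wint x t : 0 < x < l -> 0 <= t <= T -> 0 <= w x t.
    move=> xl; apply: (within_continuous_ge0 T0 (cwt x _)); first by lra.
    by move=> s; exact: winterior.
  move=> x t xl tT; rewrite -subr_ge0 -/(w x t); move: x xl.
  by apply: (within_continuous_ge0 l0 (cwx t tT)) => x xl; exact: wint.
move=> /andP[x0 xl] /andP[t0 tT]; rewrite leNgt; apply/negP => wneg.
(* With this slope the tilted function equals [w x t / 2 < 0] at [(x, t)], so its minimum is still
   negative. *)
pose e := - w x t / (2 * t).
have e0 : 0 < e by rewrite divr_gt0// ?oppr_gt0// mulr_gt0.
have et : e * t = - w x t / 2 by rewrite /e; field; rewrite gt_eqF.
(* As [x < l] and [t < T], a minimum on the right or top side of [K] is still interior to the full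
   rectangle; and [K] contains all of the past that the Caputo derivatives see. *)
pose K := `[0, x]%classic `*` `[0, t]%classic.
pose W (z : R * R) := w z.1 z.2 + e * z.2.
have KE z : K z <-> (0 <= z.1 <= x) /\ (0 <= z.2 <= t) by rewrite /K /= !in_itv.
have cW : {within K, continuous W}.
  have sub : K `<=` [set z : R * R | 0 <= z.1 <= l /\ 0 <= z.2 <= T].
    by move=> z /KE/= [? ?]; lra.
  have c1 := continuous_subspaceW sub cu1; have c2 := continuous_subspaceW sub cu2.
  have c3 : {within K, continuous (fun z : R * R => e * z.2)}.
    apply: continuous_subspaceT => z; apply: cvgM; first exact: cvg_cst.
    exact: cvg_snd.
  move=> z; apply: cvgD; last exact: c3.
  by apply: cvgB; [exact: c1|exact: c2].
have K0 : K !=set0 by exists (x, t); apply/KE => /=; lra.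
have cK : compact K by apply: compact_setX; exact: segment_compact.
have [[y s] /set_mem/KE/= [/andP[y0 yx] /andP[s0 st]] ymin] := compact_EVT_min K0 cK cW.
have {}ymin y' s' : 0 <= y' <= x -> 0 <= s' <= t -> w y s + e * s <= w y' s' + e * s'.
  by move=> h1 h2; apply: (ymin (y', s')); apply/mem_set/KE.
have wys : w y s < 0.
  have : w y s + e * s <= w x t + e * t by apply: ymin; lra.
  have : 0 <= e * s by rewrite mulr_ge0// ltW.
  lra.
have {}y0 : 0 < y.
  rewrite lt_neqAle y0 andbT; apply: contraTneq wys => <-.
  by rewrite -leNgt w0t// s0/=; lra.
have {}s0 : 0 < s.
  rewrite lt_neqAle s0 andbT; apply: contraTneq wys => <-.
  by rewrite -leNgt wx0//; lra.
have yl : 0 < y < l by lra.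
have sT : 0 < s < T by lra.
(* Along the time segment, minimality of the tilted function is exactly the hypothesis of
   [caputo_le] with slope [e], whence strictness. *)
have time i : caputo (alpha i) (fun s => u1 y s) s < caputo (alpha i) (fun s => u2 y s) s.
  have [C C0] : exists2 C, 0 < C & caputo (alpha i) (fun s => u1 y s) s + C * e
      <= caputo (alpha i) (fun s => u2 y s) s.
    apply: (@caputo_le _ _ _ _ T) => //; [lra| | | | | | |exact: ltW|].
    - by apply: (rect_section_time cu1); lra.
    - by apply: (rect_section_time cu2); lra.
    - exact: sol_W11_time s1 _ yl.
    - exact: sol_W11_time s2 _ yl.
    - exact: sol_caputo_time s1 _ _ yl sT i.
    - exact: sol_caputo_time s2 _ _ yl sT i.
    - move=> s' s's; have := ymin y s'; rewrite /w mulrBr => /(_ _ _) H.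
      by have : u1 y s - u2 y s + e * s <= u1 y s' - u2 y s' + e * s'; [apply: H; lra|lra].
  by apply: lt_le_trans; rewrite ltrDl mulr_gt0.
(* At fixed time the tilt cancels, so [caputo_le] is applied with slope 0. *)
have space j : caputo (beta j) (fun y => u1 y s) y <= caputo (beta j) (fun y => u2 y s) y.
  have [C C0] : exists2 C, 0 < C & caputo (beta j) (fun y => u1 y s) y + C * 0
      <= caputo (beta j) (fun y => u2 y s) y.
    apply: (@caputo_le _ _ _ _ l) => //; [lra| | | | | | |].
    - by apply: (rect_section_space cu1); lra.
    - by apply: (rect_section_space cu2); lra.
    - exact: sol_W11_space s1 _ sT.
    - exact: sol_W11_space s2 _ sT.
    - exact: sol_caputo_space s1 _ _ yl sT j.
    - exact: sol_caputo_space s2 _ _ yl sT j.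
    - move=> y' y'y; have := ymin y' s; rewrite /w mul0r addr0 => /(_ _ _) H.
      by have : u1 y s - u2 y s + e * s <= u1 y' s - u2 y' s + e * s; [apply: H; lra|lra].
  by rewrite mulr0 addr0.
(* The equations turn this comparison of right-hand sides into one of left-hand sides, whose order
   is strictly opposite. *)
have := rhs y s yl sT; rewrite -subr_lt0 => /(_ wys).
rewrite -(sol_equation s1 yl sT) -(sol_equation s2 yl sT); apply/negP; rewrite -ltNge.
apply: ltr_leD.
  by apply: ltr_sum_weighted => // [i|]; [exact: p0|exact: sp].
by apply: ler_sum => j _; rewrite ler_wpM2l// q0.
Qed.

(** * The zero function as a solution *)

Section Zero.
Context {R : realType}.

Lemma W11_0 (a b : R) : W11 a b (fun=> 0).
Proof.
split; first exact: integrable0.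
exists (fun=> 0); first exact: integrable0.
move=> phi _; under eq_Rintegral do rewrite mul0r.
under [in RHS]eq_Rintegral do rewrite mul0r.
by rewrite Rintegral_cst// mul0r oppr0.
Qed.

Lemma caputo_kernel0 (alpha t : R) : caputo_kernel alpha (fun=> 0) t = fun=> 0.
Proof. by apply/funext => s; rewrite /caputo_kernel derive1_cst mulr0. Qed.

Lemma caputo0 (alpha t : R) : caputo alpha (fun=> 0) t = 0.
Proof.
rewrite /caputo caputo_kernel0 derive1_cst; case: ifP => // _.
by rewrite Rintegral_cst// mul0r mulr0.
Qed.

Lemma caputo_exists0 (alpha t : R) : caputo_exists alpha (fun=> 0) t.
Proof.
rewrite /caputo_exists caputo_kernel0; case: ifP => _; first exact: integrable0.
exact: derivable_cst.
Qed.

(** Serves as a competitor: comparison with it shows that solutions with nonnegative data are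
    nonnegative. *)
Lemma is_solution0 (l T : R) (n m : nat) (alpha : 'I_n -> R) (beta : 'I_m -> R)
    (p : 'I_n -> R -> R -> R) (q : 'I_m -> R -> R -> R) (r : R -> R -> R) :
  is_solution l T alpha beta p q r (fun=> 0) (fun=> 0) (fun _ _ => 0) (fun _ _ => 0).
Proof.
split => //.
- by apply: continuous_subspaceT => z; exact: cvg_cst.
- by move=> t _; exact: W11_0.
- by move=> x _; exact: W11_0.
- by move=> x t _ _ i; exact: caputo_exists0.
- by move=> x t _ _ i; exact: caputo_exists0.
- move=> x t _ _; rewrite mulr0 addr0 !big1 ?addr0// => i _;
    by rewrite caputo0 mulr0.
Qed.

End Zero.
Unset Implicit Arguments.
Theorem corollary3p4 (R : realType) (l T : R) (hl : 0 < l) (hT : 0 < T)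
    (n m : nat) (hn : (1 <= n)%N) (hm : (1 <= m)%N)
    (alpha : 'I_n -> R) (beta : 'I_m -> R)
    (halpha : forall i, 0 < alpha i <= 1)
    (halpha_incr : forall i j : 'I_n, (i < j)%N -> alpha i < alpha j)
    (hbeta : forall j, 0 < beta j <= 1)
    (hbeta_incr : forall i j : 'I_m, (i < j)%N -> beta i < beta j)
    (p : 'I_n -> R -> R -> R) (q : 'I_m -> R -> R -> R)
    (hp_cont : forall i, continuous_on_rect l T (p i))
    (hq_cont : forall j, continuous_on_rect l T (q j))
    (hp : forall i x t, 0 < x < l -> 0 < t < T -> 0 <= p i x t)
    (hq : forall j x t, 0 < x < l -> 0 < t < T -> 0 <= q j x t)
    (hp_sum : forall x t, 0 <= x <= l -> 0 <= t <= T ->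
       0 < \sum_(i < n) p i x t) :
  (forall (r F1 F2 : R -> R -> R) (a1 a2 g1 g2 : R -> R) (u1 u2 : R -> R -> R),
     continuous_on_rect l T r ->
     continuous_on_rect l T F1 -> continuous_on_rect l T F2 ->
     (forall x t, 0 <= x <= l -> 0 <= t <= T -> F2 x t <= F1 x t) ->
     (forall t, 0 <= t <= T -> g2 t <= g1 t) ->
     (forall x, 0 <= x <= l -> a2 x <= a1 x) ->
     (forall x t, 0 <= x <= l -> 0 <= t <= T -> r x t <= 0) ->
     is_solution l T alpha beta p q r a1 g1 F1 u1 ->
     is_solution l T alpha beta p q r a2 g2 F2 u2 ->
     forall x t, 0 <= x <= l -> 0 <= t <= T -> u2 x t <= u1 x t)
  /\
  (forall (r1 r2 F1 F2 : R -> R -> R) (a1 a2 g1 g2 : R -> R)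
      (u1 u2 : R -> R -> R),
     continuous_on_rect l T r1 -> continuous_on_rect l T r2 ->
     continuous_on_rect l T F1 -> continuous_on_rect l T F2 ->
     (forall x t, 0 <= x <= l -> 0 <= t <= T -> 0 <= F2 x t <= F1 x t) ->
     (forall t, 0 <= t <= T -> 0 <= g2 t <= g1 t) ->
     (forall x, 0 <= x <= l -> 0 <= a2 x <= a1 x) ->
     (forall x t, 0 <= x <= l -> 0 <= t <= T -> r2 x t <= r1 x t <= 0) ->
     is_solution l T alpha beta p q r1 a1 g1 F1 u1 ->
     is_solution l T alpha beta p q r2 a2 g2 F2 u2 ->
     forall x t, 0 <= x <= l -> 0 <= t <= T -> u2 x t <= u1 x t).
Proof.
have spos x t : 0 < x < l -> 0 < t < T -> 0 < \sum_(i < n) p i x t.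
  by move=> xl tT; apply: hp_sum; lra.
have mono (r F1 F2 : R -> R -> R) (a1 a2 g1 g2 : R -> R) (u1 u2 : R -> R -> R) :
    (forall x t, 0 <= x <= l -> 0 <= t <= T -> F2 x t <= F1 x t) ->
    (forall t, 0 <= t <= T -> g2 t <= g1 t) ->
    (forall x, 0 <= x <= l -> a2 x <= a1 x) ->
    (forall x t, 0 <= x <= l -> 0 <= t <= T -> r x t <= 0) ->
    is_solution l T alpha beta p q r a1 g1 F1 u1 ->
    is_solution l T alpha beta p q r a2 g2 F2 u2 ->
    forall x t, 0 <= x <= l -> 0 <= t <= T -> u2 x t <= u1 x t.
  move=> F12 g12 a12 r0 s1 s2.
  apply: (comparison_principle hl hT halpha hbeta hp hq spos _ _ s1 s2).
  - by move=> t tT; apply: g12; lra.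
  - by move=> x xl; apply: a12; lra.
  - move=> x t xl tT u12; rewrite lerD//; last by apply: F12; lra.
    (* Multiplication by [r x t <= 0] reverses [u1 x t < u2 x t]. *)
    by rewrite ler_wnM2l ?(ltW u12)//; apply: r0; lra.
split; first by move=> r F1 F2 a1 a2 g1 g2 u1 u2 _ _ _; exact: mono.
move=> r1 r2 F1 F2 a1 a2 g1 g2 u1 u2 _ _ _ _ hF hg ha hr s1 s2.
(* Part (i) with coefficient [r2], against the zero solution. *)
have u20 x t : 0 <= x <= l -> 0 <= t <= T -> 0 <= u2 x t.
  apply: (mono r2 F2 (fun _ _ => 0) a2 (fun=> 0) g2 (fun=> 0) u2 (fun _ _ => 0)) => //.
  - by move=> y s yl sT; have /andP[] := hF _ _ yl sT.
  - by move=> s sT; have /andP[] := hg _ sT.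
  - by move=> y yl; have /andP[] := ha _ yl.
  - by move=> y s yl sT; have /andP[/le_trans h /h] := hr _ _ yl sT.
  - exact: is_solution0.
apply: (comparison_principle hl hT halpha hbeta hp hq spos _ _ s1 s2).
- by move=> t tT; have /andP[] : 0 <= g2 t <= g1 t by apply: hg; lra.
- by move=> x xl; have /andP[] : 0 <= a2 x <= a1 x by apply: ha; lra.
- move=> x t xl tT u12.
  have xl' : 0 <= x <= l by lra.
  have tT' : 0 <= t <= T by lra.
  have /andP[_ F12] := hF _ _ xl' tT'.
  have /andP[r12 r10] := hr _ _ xl' tT'.
  (* The intermediate term changes one factor at a time: first [r2] to [r1], using [u2 >= 0], then
     [u2] to [u1], using [r1 <= 0]. *)
  rewrite lerD// (@le_trans _ _ (r1 x t * u2 x t))//.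
    by rewrite ler_wpM2r// u20.
  by rewrite ler_wnM2l// ltW.
Qed.
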